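(* Let $X$ be a topological space. The uniform norm topology on $B_1^*(X)$ is the same as the relative $m_B$-topology on $B_1^*(X)$ (the subspace topology inherited from $B_1(X)$ with the $m_B$-topology) if and only if $B_1(X)=B_1^*(X)$.
   Context: A Baire one function on a topological space $X$ is a function $f:X\to\mathbb{R}$ that is the pointwise limit of a sequence of continuous real-valued functions on $X$. $B_1(X)$ is the commutative ring, under pointwise operations, of all Baire one functions on $X$, and $B_1^*(X)$ is its subring of bounded functions. The uniform norm topology on $B_1^*(X)$ is the topology induced by the norm $\|f\|=\sup_{x\in X}|f(x)|$. A positive unit of $B_1(X)$ is a unit $u$ of the ring $B_1(X)$ with $u(x)>0$ for all $x\in X$. The $m_B$-topology on $B_1(X)$ is the topology having as an open base the sets $\widetilde{M}(g,u)=\{f\in B_1(X): |f(x)-g(x)|<u(x)\text{ for every }x\in X\}$, where $g\in B_1(X)$ and $u$ is a positive unit of $B_1(X)$. *)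

(* Defs.v *)
From HB Require Import structures.
From mathcomp Require Import all_boot all_order all_algebra.
From mathcomp Require Import all_classical all_reals all_analysis.

Set Implicit Arguments.
Unset Strict Implicit.
Unset Printing Implicit Defensive.

Import Order.TTheory GRing.Theory Num.Theory.
Import numFieldNormedType.Exports.

Local Open Scope classical_set_scope.
Local Open Scope ring_scope.

Definition baire_one (R : realType) (X : topologicalType) (f : X -> R) : Prop :=
  exists2 f_ : nat -> X -> R,
    (forall n, continuous (f_ n)) & (forall x, f_ n x @[n --> \oo] --> f x).

Section baire_one_closure.
Context {R : realType} {X : topologicalType}.
Implicit Types f g : X -> R.

Lemma baire_one_cst (c : R) : baire_one (cst c : X -> R).
Proof. by exists (fun=> cst c) => [n x|x]; exact: cvg_cst. Qed.

Lemma baire_oneD f g : baire_one f -> baire_one g -> baire_one (f + g).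
Proof.
move=> [f_ cf lf] [g_ cg lg]; exists (fun n => f_ n + g_ n) => [n x|x].
  by apply: continuousD; [exact: cf|exact: cg].
exact: (cvgD (lf x) (lg x)).
Qed.

Lemma baire_oneN f : baire_one f -> baire_one (- f).
Proof.
move=> [f_ cf lf]; exists (fun n => - f_ n) => [n x|x].
  by apply: continuousN; exact: cf.
exact: (cvgN (lf x)).
Qed.

Lemma baire_oneM f g : baire_one f -> baire_one g -> baire_one (f * g).
Proof.
move=> [f_ cf lf] [g_ cg lg]; exists (fun n => f_ n * g_ n) => [n x|x].
  by apply: continuousM; [exact: cf|exact: cg].
exact: (cvgM (lf x) (lg x)).
Qed.

Lemma baire_one_norm f : baire_one f -> baire_one (fun x => `|f x|).
Proof.
move=> [f_ cf lf]; exists (fun n x => `|f_ n x|) => [n x|x].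
  by apply: (@cvg_norm _ R); exact: cf.
exact: (@cvg_norm _ R _ _ _ _ _ (lf x)).
Qed.

Lemma baire_one_max f g : baire_one f -> baire_one g ->
  baire_one (fun x => Num.max (f x) (g x)).
Proof.
move=> bf bg.
have -> : (fun x => Num.max (f x) (g x)) =
    cst 2^-1 * ((f + g) + (fun x => `|(f - g) x|)).
  by apply/funext => x; rewrite maxr_absE mulrC.
apply: baire_oneM; first exact: baire_one_cst.
apply: baire_oneD; first exact: baire_oneD.
by apply: baire_one_norm; apply: baire_oneD => //; exact: baire_oneN.
Qed.

Lemma baire_one_min f g : baire_one f -> baire_one g ->
  baire_one (fun x => Num.min (f x) (g x)).
Proof.
move=> bf bg.
have -> : (fun x => Num.min (f x) (g x)) =
    - (fun x => Num.max ((- f) x) ((- g) x)).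
  by apply/funext => x; rewrite [RHS]oppr_max !opprK.
by apply: baire_oneN; apply: baire_one_max; exact: baire_oneN.
Qed.

Lemma baire_oneV f : (forall x, 0 < f x) -> baire_one f ->
  baire_one (fun x => (f x)^-1).
Proof.
move=> f0 [f_ cf lf].
have h0 n : 0 < (harmonic n : R) by rewrite /harmonic /= invr_gt0.
exists (fun n x => (`|f_ n x| + harmonic n)^-1) => [n x|x].
  apply: cvgV; first by rewrite gt_eqF// ltr_wpDl.
  apply: cvgD; last exact: cvg_cst.
  by apply: (@cvg_norm _ R); exact: cf.
apply: cvgV; first by rewrite gt_eqF.
rewrite -[X in _ --> X]addr0 -[X in _ --> X + _](gtr0_norm (f0 x)).
by apply: cvgD; [exact: (@cvg_norm _ R _ _ _ _ _ (lf x))|exact: cvg_harmonic].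
Qed.

End baire_one_closure.

Section baire1.
Context (R : realType) (X : topologicalType).

Definition baire_one_pred : {pred X -> R} := mem [set f | baire_one f].

Lemma baire_one_subring_closed : subring_closed baire_one_pred.
Proof.
split; first by rewrite inE; exact: (baire_one_cst 1).
  by move=> f g; rewrite !inE/= => bf bg; apply: baire_oneD => //; exact: baire_oneN.
by move=> f g; rewrite !inE/=; exact: baire_oneM.
Qed.

Record baire1 := Baire1 { baire1_fun :> X -> R ; _ : baire1_fun \in baire_one_pred }.

HB.instance Definition _ := [isSub for baire1_fun].
HB.instance Definition _ := [Choice of baire1 by <:].
HB.instance Definition _ := GRing.SubChoice_isSubComPzRing.Build
  (X -> R) baire_one_pred baire1 baire_one_subring_closed.
HB.instance Definition _ := isPointed.Build baire1 0.

Lemma baire1P (f : baire1) : baire_one f.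
Proof. by have := valP f; rewrite inE. Qed.

Lemma mem_baire1 (f : X -> R) : baire_one f -> f \in baire_one_pred.
Proof. by move=> bf; rewrite inE. Qed.

(** [GRing.unit] is not available here, since $B_1(\emptyset)$ is the zero ring. *)
Definition positive_unit (u : baire1) : Prop :=
  (exists v : baire1, u * v = 1) /\ forall x, 0 < u x.

Definition mB_ball (g u : baire1) : set baire1 :=
  [set f | forall x, `|f x - g x| < u x].

Lemma positive_unitP (u : X -> R) (bu : baire_one u) :
  (forall x, 0 < u x) -> positive_unit (Baire1 (mem_baire1 bu)).
Proof.
move=> u0; split=> //=; exists (Baire1 (mem_baire1 (baire_oneV u0 bu))).
apply/val_inj/funext => x /=.
by rewrite /GRing.mul /= mulfV// gt_eqF.
Qed.

Let mB_index : set (baire1 * baire1) := [set gu | positive_unit gu.2].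

Let mB_base (gu : baire1 * baire1) : set baire1 := mB_ball gu.1 gu.2.

Let mB_cover : \bigcup_(gu in mB_index) mB_base gu = setT.
Proof.
apply/seteqP; split=> // f _; exists (f, 1) => [|x /=].
  by split=> [|x]; [exists 1; rewrite mulr1|exact: ltr01].
by rewrite subrr normr0; exact: ltr01.
Qed.

Let mB_join (i j : baire1 * baire1) (f : baire1) : mB_index i -> mB_index j ->
  mB_base i f -> mB_base j f ->
  exists k, [/\ mB_index k, mB_base k f & mB_base k `<=` mB_base i `&` mB_base j].
Proof.
move: i j => [g u] [h v] /= _ _ gf hf.
pose gap (g u : baire1) : X -> R :=
  (u : X -> R) - (fun x => `|f x - g x|).
have bgap (a b : baire1) : baire_one (gap a b).
  apply: baire_oneD; first exact: baire1P.
  apply: baire_oneN; apply: baire_one_norm.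
  exact: (baire_oneD (baire1P _) (baire_oneN (baire1P _))).
have bw := baire_one_min (bgap g u) (bgap h v).
have w0 x : 0 < Num.min (gap g u x) (gap h v x).
  rewrite lt_min; apply/andP; split; rewrite /gap /=.
    by have := gf x; rewrite -subr_gt0.
  by have := hf x; rewrite -subr_gt0.
exists (f, Baire1 (mem_baire1 bw)); split => /=.
- exact: positive_unitP.
- by move=> x /=; rewrite subrr normr0.
- move=> k kw.
  have tri (a b : baire1) x : `|k x - f x| < gap a b x -> `|k x - a x| < b x.
    move=> kf; rewrite -(subrKA (f x)) (le_lt_trans (ler_normD _ _))//.
    by rewrite -ltrBrDr.
  by split=> x /=; apply: tri; have := kw x; rewrite /= lt_min => /andP[].
Qed.

(** The m_B-topology is the canonical topology of [baire1]. *)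
HB.instance Definition _ := isBaseTopological.Build baire1 mB_cover mB_join.

End baire1.

Section baire1_bounded.
Context (R : realType) (X : topologicalType).

Definition bounded_baire1 : set (baire1 R X) :=
  [set f | bounded_fun (f : X -> R)].

Definition bounded_baire1_pred : {pred baire1 R X} := mem bounded_baire1.

Lemma bounded_baire1P (f : baire1 R X) :
  bounded_baire1 f <-> exists M, forall x, `|f x| <= M.
Proof.
split=> [/pinfty_ex_gt0[M _ fM]|[M fM]]; first by exists M => x; exact: fM.
have : \forall N \near +oo, M <= N by exact: nbhs_pinfty_ge (num_real M).
by apply: filterS => N MN x _; exact: le_trans MN.
Qed.

Lemma bounded_baire1_subring_closed : subring_closed bounded_baire1_pred.
Proof.
split.
- by rewrite inE; apply/bounded_baire1P; exists 1 => x; rewrite normr1.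
- move=> f g; rewrite !inE => /bounded_baire1P[M fM] /bounded_baire1P[N gN].
  apply/(bounded_baire1P (f - g)); exists (M + N) => x.
  exact: (le_trans (ler_normB (f x) (g x)) (lerD (fM x) (gN x))).
- move=> f g; rewrite !inE => /bounded_baire1P[M fM] /bounded_baire1P[N gN].
  apply/(bounded_baire1P (f * g)); exists (M * N) => x.
  by have -> : (f * g) x = f x * g x by []; rewrite normrM ler_pM.
Qed.

Record baire1b :=
  Baire1b { baire1b_val :> baire1 R X ; _ : baire1b_val \in bounded_baire1_pred }.

HB.instance Definition _ := [isSub for baire1b_val].
HB.instance Definition _ := [Choice of baire1b by <:].
HB.instance Definition _ := GRing.SubChoice_isSubComPzRing.Build
  (baire1 R X) bounded_baire1_pred baire1b bounded_baire1_subring_closed.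

(** On the empty space this is [sup set0 = 0]. *)
Definition uniform_norm (f : baire1b) : R := sup (range (fun x => `|f x|)).

Lemma uniform_norm_ub (f : baire1b) x : `|f x| <= uniform_norm f.
Proof.
have [|M fM] := (bounded_baire1P f).1; first by have := valP f; rewrite inE.
by apply: ub_le_sup; [exists M => _ [y _ <-]|exists x].
Qed.

Lemma uniform_norm_le (f : baire1b) (M : R) : 0 <= M ->
  (forall x, `|f x| <= M) -> uniform_norm f <= M.
Proof.
move=> M0 fM; rewrite /uniform_norm.
have [->|/set0P ne] := eqVneq (range (fun x => `|f x|)) set0; first by rewrite sup0.
by apply: ge_sup => // _ [x _ <-].
Qed.

Lemma uniform_norm_ge0 (f : baire1b) : 0 <= uniform_norm f.
Proof.
rewrite /uniform_norm.
have [->|/set0P[_ [x _ _]]] := eqVneq (range (fun x => `|f x|)) set0.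
  by rewrite sup0.
exact: le_trans (normr_ge0 _) (uniform_norm_ub f x).
Qed.

Let uniform_normD (f g : baire1b) :
  uniform_norm (f + g) <= uniform_norm f + uniform_norm g.
Proof.
apply: uniform_norm_le => [|x]; first by rewrite addr_ge0// uniform_norm_ge0.
apply: le_trans (ler_normD (f x) (g x)) _.
by rewrite lerD// uniform_norm_ub.
Qed.

Let uniform_norm0_eq0 (f : baire1b) : uniform_norm f = 0 -> f = 0.
Proof.
move=> f0; apply/val_inj/val_inj/funext => x; apply/normr0_eq0/le_anti.
by rewrite normr_ge0 andbT -f0; exact: uniform_norm_ub.
Qed.

Let uniform_normN (f : baire1b) : uniform_norm (- f) = uniform_norm f.
Proof.
by congr sup; apply: eq_imagel => x _; exact: normrN.
Qed.

Let uniform_normMn (f : baire1b) n :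
  uniform_norm (f *+ n) = uniform_norm f *+ n.
Proof.
have fnx x : (f *+ n) x = f x *+ n.
  by elim: n => [//|n IHn]; rewrite !mulrS -IHn.
apply/le_anti/andP; split.
  apply: uniform_norm_le => [|x]; first by rewrite mulrn_wge0// uniform_norm_ge0.
  by rewrite fnx normrMn lerMn2r uniform_norm_ub orbT.
case: n fnx => [|n] fnx; first by rewrite !mulr0n uniform_norm_ge0.
rewrite -mulr_natr -ler_pdivlMr ?ltr0n//; apply: uniform_norm_le => [|x].
  by rewrite divr_ge0// uniform_norm_ge0.
by rewrite ler_pdivlMr ?ltr0n// mulr_natr -normrMn -fnx uniform_norm_ub.
Qed.

HB.instance Definition _ := Num.Zmodule_isNormed.Build R baire1b
  uniform_normD uniform_norm0_eq0 uniform_normMn uniform_normN.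

End baire1_bounded.

(** Both are sets of subsets of [baire1b R X]; the types [pseudoMetric_normed T]
    and [initial_topology (f : T -> _)] are aliases of [T]. *)
Definition uniform_norm_topology (R : realType) (X : topologicalType) :
    set (set (baire1b R X)) :=
  @open (pseudoMetric_normed (baire1b R X)).

Definition relative_mB_topology (R : realType) (X : topologicalType) :
    set (set (baire1b R X)) :=
  @open (initial_topology (@baire1b_val R X)).

Arguments bounded_baire1 : clear implicits.
Arguments uniform_norm_topology : clear implicits.
Arguments relative_mB_topology : clear implicits.

(* Main.v *)
(** The uniform topology is always coarser than the relative m_B-topology, since
    positive constants are positive units. If the two agree and [f] is Baire one,
    the trace of the m_B-ball of radius [1 / (1 + |f|)] around [0] contains a
    uniform ball, hence a positive constant, and so [f] is bounded. Conversely, if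
    every Baire one function is bounded, so is the inverse of a positive unit;
    positive units are then bounded away from [0], and m_B-balls contain uniform
    balls. *)

Require Import Defs.
From mathcomp Require Import all_boot all_order all_algebra.
From mathcomp Require Import all_classical all_reals all_analysis.
From mathcomp Require Import lra.

Set Implicit Arguments.
Unset Strict Implicit.
Unset Printing Implicit Defensive.

Import Order.TTheory GRing.Theory Num.Theory.
Import numFieldNormedType.Exports.

Local Open Scope classical_set_scope.
Local Open Scope ring_scope.

Section mB_topology.
Context {R : realType} {X : topologicalType}.
Implicit Types (f g u : baire1 R X) (e : R).

Lemma open_mB_ball g u : positive_unit u -> open (mB_ball g u).
Proof.
move=> pu; exists [set (g, u)] => [_ ->//|].
by rewrite bigcup_set1.
Qed.

Lemma mB_ball_gap g f u : mB_ball g u f ->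
  exists2 w, positive_unit w & mB_ball f w `<=` mB_ball g u.
Proof.
move=> fgu.
have bw : baire_one ((u : X -> R) - (fun x => `|f x - g x|)).
  apply: baire_oneD; first exact: baire1P.
  apply/baire_oneN/baire_one_norm.
  exact: (baire_oneD (baire1P f) (baire_oneN (baire1P g))).
exists (Baire1 (mem_baire1 bw)) => [|h hf x].
  by apply: positive_unitP => x; rewrite -[ltRHS]/(_ - _) subr_gt0; exact: fgu.
rewrite -(subrKA (f x)) (le_lt_trans (ler_normD _ _))//.
by rewrite -ltrBrDr; exact: hf.
Qed.

Lemma open_mBP (V : set (baire1 R X)) : open V <->
  forall f, V f -> exists2 u, positive_unit u & mB_ball f u `<=` V.
Proof.
split=> [[D' _ <-] f [[g u] D'gu fgu]|VP].
  have [w pw fw] := mB_ball_gap fgu.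
  by exists w => // h /fw ghu; exists (g, u).
rewrite openE => f /VP[u pu fuV]; rewrite /interior nbhsE.
exists (mB_ball f u) => //; split; first exact: open_mB_ball.
by move=> x; rewrite subrr normr0; case: pu.
Qed.

Lemma positive_unit_bounded_below u : [set: baire1 R X] = bounded_baire1 R X ->
  positive_unit u -> exists2 e, 0 < e & forall x, e <= u x.
Proof.
move=> allb [[v uv1] u0].
have uvx x : u x * v x = 1 by rewrite -[LHS]/((u * v) x) uv1.
have /bounded_baire1P[M vM] : bounded_baire1 R X v by rewrite -allb.
exists (`|M| + 1)^-1 => [|x]; first by rewrite invr_gt0 ltr_wpDl.
have uV : (u x)^-1 = v x by rewrite -[LHS]mulr1 -(uvx x) mulKf// gt_eqF.
rewrite invf_ple ?posrE ?ltr_wpDl// uV.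
have := vM x; have := ler_norm (v x); have := ler_norm M; lra.
Qed.

End mB_topology.

Lemma open_uniform_normP (R : realType) (X : topologicalType)
    (O : set (baire1b R X)) : uniform_norm_topology R X O <->
  forall f, O f ->
    exists2 e : R, 0 < e & forall g, uniform_norm (f - g) < e -> O g.
Proof.
rewrite /uniform_norm_topology openE.
split=> [OP f /OP|OP f /OP[e e0 eO]].
  by move=> /nbhs_ballP[e /= e0 eO]; exists e.
by apply/nbhs_ballP; exists e.
Qed.

Lemma uniform_norm_sub_relative (R : realType) (X : topologicalType) :
  uniform_norm_topology R X `<=` relative_mB_topology R X.
Proof.
move=> O /open_uniform_normP OP.
pose good (gu : baire1 R X * baire1 R X) :=
  positive_unit gu.2 /\ @baire1b_val R X @^-1` mB_ball gu.1 gu.2 `<=` O.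
exists (\bigcup_(gu in good) mB_ball gu.1 gu.2).
  by apply: bigcup_open => -[g u] [pu _]; exact: open_mB_ball.
apply/seteqP; split=> [f [gu [_ guO]] fgu|f Of]; first exact: guO.
have [e e0 eO] := OP _ Of.
have e20 : 0 < e / 2 by rewrite divr_gt0.
exists (baire1b_val f, Baire1 (mem_baire1 (baire_one_cst (e / 2)))); last first.
  by move=> x /=; rewrite subrr normr0.
split=> [|g gf]; first exact: positive_unitP.
apply: eO; apply: (@le_lt_trans _ _ (e / 2)); last by lra.
apply: uniform_norm_le => [|x]; first exact: ltW.
by rewrite -[_ x]/(f x - g x) distrC; exact/ltW/gf.
Qed.

Theorem theorem2p18 (R : realType) (X : topologicalType) :
  uniform_norm_topology R X = relative_mB_topology R X <->
  [set: baire1 R X] = bounded_baire1 R X.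
Proof.
split=> [eqt|allb].
  apply/esym/seteqP; split=> // f _; apply/bounded_baire1P.
  have bu := baire_oneD (baire_one_cst 1) (baire_one_norm (baire1P f)).
  have u0 x : 0 < (cst 1 + (fun y => `|f y|)) x.
    by rewrite -[ltRHS]/(1 + `|f x|) ltr_pwDl.
  have pv := positive_unitP (baire_oneV u0 bu) (fun x => etrans (invr_gt0 _) (u0 x)).
  set v := Baire1 _ in pv.
  have : relative_mB_topology R X (@baire1b_val R X @^-1` mB_ball 0 v).
    by exists (mB_ball 0 v) => //; exact: open_mB_ball.
  rewrite -eqt => /open_uniform_normP /(_ 0)[x|e e0 eV].
    by rewrite subrr normr0; case: pv.
  have bc : bounded_baire1 R X (Baire1 (mem_baire1 (baire_one_cst (e / 2)))).
    by apply/bounded_baire1P; exists `|e / 2| => x.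
  exists (2 / e) => x.
  have cv : mB_ball 0 v (Baire1b (mem_set bc)).
    apply: eV; apply: (@le_lt_trans _ _ (e / 2)); last by lra.
    apply: uniform_norm_le => [|y]; first by rewrite divr_ge0// ltW.
    by rewrite -[_ y]/(0 - e / 2) sub0r normrN ger0_norm// divr_ge0// ltW.
  have : `|e / 2 - 0| < (1 + `|f x|)^-1 := cv x.
  rewrite subr0 gtr0_norm ?divr_gt0// -[e / 2]invrK.
  rewrite ltf_pV2 ?posrE ?invr_gt0 ?divr_gt0 ?ltr_pwDl// invf_div.
  lra.
apply/seteqP; split; first exact: uniform_norm_sub_relative.
move=> _ [V /open_mBP VP <-]; apply/open_uniform_normP => f /VP[u pu uV].
have [e e0 eu] := positive_unit_bounded_below allb pu.
exists e => // g fge; apply: uV => x; apply: lt_le_trans (eu x).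
rewrite distrC; apply: le_lt_trans fge; exact: (uniform_norm_ub (f - g)).
Qed.
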